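(* Let $W:\mathbb C^r\to\mathbb C^d$ be an operator and let $\Delta$ be the diagonal map on operators on $\mathbb C^r$ with respect to a fixed basis of $\mathbb C^r$. Consider the operator system $\mathfrak S$ on $\mathbb C^d$ defined as the set of all operators $X$ on $\mathbb C^d$ which satisfy $$\Delta(W^*XW)=\frac{\operatorname{Tr}(X)}{d}\,\Delta(W^*W).$$ If $\mathfrak A$ is a $C^*$-subalgebra of $\mathfrak S$ (that is, a $C^*$-algebra of operators on $\mathbb C^d$ contained in $\mathfrak S$), then $\mathfrak A$ has a separating vector.
   Context: For a fixed (orthonormal) basis $\{|k\rangle\}$ of $\mathbb C^r$, $\Delta(\rho)=\sum_k|k\rangle\langle k|\rho|k\rangle\langle k|$; i.e. $\Delta$ zeros out the off-diagonal entries of the matrix of $\rho$ in this basis and leaves the diagonal entries unchanged. An operator system on $\mathbb C^d$ is a linear subspace of $B(\mathbb C^d)$ that contains the identity and is closed under adjoints. A vector $|\psi\rangle\in\mathbb C^d$ is a separating vector of a set $\mathfrak A\subseteq B(\mathbb C^d)$ if $A|\psi\rangle\neq0$ for every nonzero $A\in\mathfrak A$.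
   Formalization: The operator W is assumed to be nonzero; for W = 0 the system is all of B(C^d), and for d ≥ 2 the full matrix algebra has no separating vector, so the statement fails there. *)

(* Defs.v *)
From HB Require Import structures.
From mathcomp Require Export all_boot all_order all_algebra.
From mathcomp Require Export complex reals.

Set Implicit Arguments.
Unset Strict Implicit.
Unset Printing Implicit Defensive.

Import Order.TTheory GRing.Theory Num.Theory.
Local Open Scope ring_scope.
Local Open Scope sesquilinear_scope.

(* The complex field is R[i] for R : realType; an operator C^n -> C^m is its
   matrix in 'M_(m, n) in the standard bases, acting on column vectors, and
   M ^t* is its adjoint. *)

Section OperatorSystems.
Variable R : realType.
Local Notation C := R[i].

(* r orthonormal vectors of C^r automatically form a basis. *)
Definition orthonormal_basis (r : nat) (e : 'I_r -> 'cV[C]_r) : Prop :=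
  forall k l : 'I_r, e k ^t* *m e l = ((k == l)%:R)%:M.

Definition Delta (r : nat) (e : 'I_r -> 'cV[C]_r) (rho : 'M[C]_r) : 'M[C]_r :=
  \sum_(k < r) e k *m e k ^t* *m rho *m e k *m e k ^t*.

Definition operator_system (d : nat) (S : {pred 'M[C]_d}) : Prop :=
  [/\ 1%:M \in S, submod_closed S & forall X, X \in S -> X ^t* \in S].

(* Linear subspaces of 'M_d are norm closed, so a C*-algebra of operators on
   C^d is just a *-closed multiplicatively closed subspace; it need not
   contain the identity matrix. *)
Definition cstar_algebra (d : nat) (A : {vspace 'M[C]_d}) : Prop :=
  (forall X Y, X \in A -> Y \in A -> X *m Y \in A) /\
  (forall X, X \in A -> X ^t* \in A).

Definition separating_vector (d : nat) (A : {pred 'M[C]_d}) (psi : 'cV[C]_d)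
    : Prop :=
  forall X, X \in A -> X != 0 -> X *m psi != 0.

Definition systemS (r d : nat) (e : 'I_r -> 'cV[C]_r) (W : 'M[C]_(d, r))
    : {pred 'M[C]_d} :=
  [pred X | Delta e (W ^t* *m X *m W)
            == (\tr X / d%:R) *: Delta e (W ^t* *m W)].

Lemma Delta_is_linear (r : nat) (e : 'I_r -> 'cV[C]_r) : linear (Delta e).
Proof.
move=> a u v; rewrite /Delta scaler_sumr -big_split; apply: eq_bigr => k _ /=.
by rewrite mulmxDr !mulmxDl -scalemxAr -!scalemxAl.
Qed.

Lemma Delta_adj (r : nat) (e : 'I_r -> 'cV[C]_r) (rho : 'M[C]_r) :
  Delta e (rho ^t*) = (Delta e rho) ^t*.
Proof.
rewrite /Delta !raddf_sum; apply: eq_bigr => k _ /=.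
by rewrite !(trmx_mul, map_mxM) !trmxCK !mulmxA.
Qed.

Lemma systemS_operator_system (r d : nat) (e : 'I_r -> 'cV[C]_r)
    (W : 'M[C]_(d, r)) : operator_system (systemS e W).
Proof.
have D0 : Delta e 0 = 0.
  by rewrite /Delta big1 // => k _; rewrite mulmx0 !mul0mx.
have DZ a u : Delta e (a *: u) = a *: Delta e u.
  by rewrite -[a *: u]addr0 Delta_is_linear D0 addr0.
split=> [||X].
- rewrite inE mulmx1 mxtrace1; case: d W => [|d'] W.
    by rewrite mul0r scale0r (flatmx0 W) mulmx0 D0.
  by rewrite divff ?pnatr_eq0 // scale1r.
- split=> [|a X Y /eqP hX /eqP hY].
    by rewrite inE mulmx0 mul0mx mxtrace0 mul0r scale0r D0.
  rewrite inE mulmxDr mulmxDl -scalemxAr -scalemxAl Delta_is_linear hX hY.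
  by rewrite mxtraceD mxtraceZ scalerA -scalerDl mulrDl mulrA.
- move=> /eqP hX; rewrite inE.
  have -> : W ^t* *m X ^t* *m W = (W ^t* *m X *m W) ^t*.
    by rewrite !(trmx_mul, map_mxM) trmxCK mulmxA.
  have -> : \tr (X ^t*) = (\tr X)^* by rewrite trace_map_mx mxtrace_tr.
  rewrite Delta_adj hX linearZ map_mxZ /= -Delta_adj.
  by rewrite !(trmx_mul, map_mxM) trmxCK fmorph_div /= conjC_nat.
Qed.

End OperatorSystems.

(* Main.v *)
(* Put psi = W e_k with W e_k <> 0.  For X in A the positive operator X^* X
   lies in A, hence in the operator system, whose k-th diagonal condition reads
   |X psi|^2 = Tr(X^* X) / d * |psi|^2.  So X psi = 0 forces Tr(X^* X) = 0. *)
Require Import Defs.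

Set Implicit Arguments.
Unset Strict Implicit.
Unset Printing Implicit Defensive.

Import Order.TTheory GRing.Theory Num.Theory.
Local Open Scope ring_scope.
Local Open Scope sesquilinear_scope.

(** The trace is the squared Frobenius norm, a sum of nonnegative terms [|X i j| ^+ 2], so it
    vanishes only if every entry does. *)
Lemma mxtrace_adj_mul_eq0 (C : numClosedFieldType) (m n : nat)
    (X : 'M[C]_(m, n)) :
  (\tr (X ^t* *m X) == 0) = (X == 0).
Proof.
apply/eqP/eqP => [|->]; last by rewrite mulmx0 mxtrace0.
have trE : \tr (X ^t* *m X) = \sum_j \sum_i `|X i j| ^+ 2.
  apply: eq_bigr => j _; rewrite mxE; apply: eq_bigr => i _.
  by rewrite !mxE normCK mulrC.
have sq_ge0 i j : 0 <= `|X i j| ^+ 2 by rewrite exprn_ge0.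
rewrite trE => /psumr_eq0P col0; apply/matrixP => i j; rewrite mxE.
have /psumr_eq0P row0 := col0 (fun j _ => sumr_ge0 _ (fun i _ => sq_ge0 i j)) j isT.
by apply/normr0_eq0/eqP; rewrite -sqrf_eq0 row0.
Qed.

Lemma adj_mulmx_sandwich (C : numClosedFieldType) (m n : nat)
    (W : 'M[C]_(m, n)) (X : 'M[C]_m) (v : 'cV[C]_n) :
  (W *m v) ^t* *m X *m (W *m v) = v ^t* *m (W ^t* *m X *m W) *m v.
Proof. by rewrite trmx_mul map_mxM !mulmxA. Qed.

Lemma separates_of_traced_form (C : numClosedFieldType) (d : nat)
    (X : 'M[C]_d) (psi : 'cV[C]_d) :
    psi ^t* *m (X ^t* *m X) *m psi =
      (\tr (X ^t* *m X) / d%:R) *: (psi ^t* *m psi) ->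
  psi != 0 -> X != 0 -> X *m psi != 0.
Proof.
(* In dimension 0 no [psi] is nonzero; in positive dimension the factor [d%:R^-1] below is
   nonzero. *)
case: d X psi => [|d] X psi; first by rewrite (flatmx0 psi) eqxx.
move=> formX psi0; apply: contraNneq => Xpsi.
(* Taking traces turns the 1 x 1 matrix identity into a vanishing product of scalars, with the
   squared norms of [X] and [psi] as factors. *)
move: formX; rewrite -!mulmxA Xpsi !mulmx0 => /esym/(congr1 mxtrace)/eqP.
rewrite mxtraceZ mxtrace0 !mulf_eq0 invr_eq0 pnatr_eq0 orbF.
by rewrite !mxtrace_adj_mul_eq0 (negPf psi0) orbF.
Qed.

Section OrthonormalBasis.
Variables (R : realType) (r : nat) (e : 'I_r -> 'cV[R[i]]_r).
Hypothesis he : orthonormal_basis e.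

(** Orthonormality kills every summand of [Delta] except the one at [k]. *)
Lemma Delta_diag (rho : 'M[R[i]]_r) (k : 'I_r) :
  e k ^t* *m Delta e rho *m e k = e k ^t* *m rho *m e k.
Proof.
rewrite /Delta mulmx_sumr mulmx_suml (bigD1 k) //= big1 => [|l lk].
  by rewrite addr0 !mulmxA he eqxx mul1mx -mulmxA he eqxx mulmx1.
by rewrite !mulmxA he eq_sym (negPf lk) mul_scalar_mx scale0r !mul0mx.
Qed.

Lemma orthonormal_basis_neq0 (d : nat) (W : 'M[R[i]]_(d, r)) :
  W != 0 -> exists k, W *m e k != 0.
Proof.
move=> W0; apply/existsP; apply: contraNT W0 => /existsPn We0.
(* [E] has the basis vectors as columns, so [W *m E] collects the vectors [W *m e k], all assumed
   zero. *)
pose E := \matrix_(i, j) e j i 0.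
have col_E k : col k E = e k.
  by apply/matrixP => i j; rewrite !mxE ord1.
have EE : E ^t* *m E = 1%:M.
  apply/matrixP => k l; have /matrixP/(_ 0 0) := he k l.
  rewrite !mxE mulr1n => <-.
  by apply: eq_bigr => i _; rewrite !mxE.
have WE : W *m E = 0.
  apply/matrixP => i j; have /negPn/eqP := We0 j.
  by rewrite -col_E colE mulmxA -colE => /matrixP/(_ i 0); rewrite !mxE.
(* As [E] is square, its left inverse is also a right inverse, whence [W = (W *m E) *m E ^t*]. *)
by rewrite -[W]mulmx1 -(mulmx1C EE) mulmxA WE mul0mx.
Qed.

(** By [Delta_diag], [Delta] can be inserted on the left and removed on the right when both sides
    are compressed to [e k]. *)
Lemma systemS_traced_form (d : nat) (W : 'M[R[i]]_(d, r)) (X : 'M[R[i]]_d)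
    (k : 'I_r) :
  X \in systemS e W ->
  (W *m e k) ^t* *m X *m (W *m e k) =
    (\tr X / d%:R) *: ((W *m e k) ^t* *m (W *m e k)).
Proof.
rewrite inE => /eqP SX.
rewrite adj_mulmx_sandwich -[LHS](Delta_diag _ k) SX.
rewrite -scalemxAr -scalemxAl; congr (_ *: _).
by rewrite [LHS](Delta_diag _ k) trmx_mul map_mxM !mulmxA.
Qed.

End OrthonormalBasis.

(** For [W = 0] the system is all of ['M_d], which has no separating vector once [d >= 2]; hence the
    hypothesis [hW]. *)
Theorem theorem1 (R : realType) (r d : nat) (e : 'I_r -> 'cV[R[i]]_r)
  (he : orthonormal_basis e) (W : 'M[R[i]]_(d, r)) (hW : W != 0)
  (A : {vspace 'M[R[i]]_d}) (hA : cstar_algebra A)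
  (hAS : {subset A <= systemS e W}) :
  exists psi : 'cV[R[i]]_d, separating_vector A psi.
Proof.
have [k psi0] := orthonormal_basis_neq0 he hW; exists (W *m e k) => X XA.
have [mulA adjA] := hA; apply: separates_of_traced_form psi0.
exact/(systemS_traced_form he)/hAS/mulA/XA/adjA.
Qed.
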